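(* Consider an instance of the Shipper Transportation Planning Problem (STPP) as defined in the context. Then: (i) The optimal value of the linear relaxation of STPP (obtained by replacing $x_\alpha^b\in\{0,1\}$ and $\tau_a^k\in\{0,1\}$ by $x_\alpha^b\in[0,1]$ and $\tau_a^k\in[0,1]$, and $f_a^m, y_{ak}^m\in\mathbb{N}$ by $f_a^m,y_{ak}^m\in\mathbb{R}_+$, and keeping $z\ge 0$) equals the optimal value of the linear program $$\min_{x,f,z}\ \sum_{a\in\mathcal{A}}\sum_{m\in M}\Big(c_{am}^{\mathrm{com}}+\frac{\ell_m}{L_a}c_a^{\mathrm{con}}\Big)f_a^m+\sum_{p\in P}c_p^{\mathrm{over}}z_p^{\mathrm{total}}$$ subject to the path constraints (F1), the elementarity constraints (F2), the projection constraints (F3), the overload constraints (O1), (O2), and $x_\alpha^b\in[0,1]$, $f_a^m\ge 0$, $z\ge 0$. (ii) If the overload constraints (O1), (O2) and the variables $z$ are removed from STPP, then the optimal value of its linear relaxation equals $$\sum_{b\in B}\ \min_{x^b,\,f}\ \sum_{a\in\mathcal{A}}\ \sum_{o\in b}\sum_{m\in o}\Big(c_{am}^{\mathrm{com}}+\frac{\ell_m}{L_a}c_a^{\mathrm{con}}\Big)f_a^m ,$$ where, for each $b\in B$, the minimum is over $x_\alpha^b\in[0,1]$ ($\alpha\in\mathscr{A}$) and $f_a^m\ge 0$ ($a\in\mathcal{A}$, $m\in o\in b$) satisfying (F1), (F2), (F3) for this bundle $b$ only. (The value of an infeasible minimization problem is $+\infty$.)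
   Context: **Network.** $D=(V,A)$ is a finite directed graph with $V=S\cup P\cup U$ (disjoint union of suppliers $S$, platforms $P$, production units $U$). The arcs go from suppliers to platforms, from platforms to other platforms, from platforms to units, or from suppliers to units. Each arc $a\in A$ has a travel time $\tau_a\in\mathbb{N}$. $T\ge1$ is the horizon and $[T]=\{1,\dots,T\}$; time indices in the time-space graph are taken modulo $T$. **Commodities.** $M$ is a finite set of commodities. Commodity $m$ has a supplier $s_m\in S$, a unit $u_m\in U$, a delivery date $d_m\in[T]$, a unit volume $\ell_m>0$ and a multiplicity $q_m\in\mathbb{N}$, $q_m\geq 1$. Commodities with the same supplier, unit and delivery date are grouped into an order $o\subseteq M$; all commodities in $o$ have delivery date $d_o$ and maximum delivery time $\tau_o\in\mathbb{N}$. The set of orders $O$ partitions $M$. Orders with the same supplier and unit (and different delivery dates) are grouped into a bundle $b\subseteq O$, with supplier $s_b$, unit $u_b$ and maximum delivery time $\tau_b\in\mathbb{N}$ common to its orders. The set of bundles $B$ partitions $O$. **Time-space graph** $\mathcal{D}=(\mathcal{V},\mathcal{A})$: $\mathcal{V}=V\times[T]$ and $\mathcal{A}=\{((u,t),(v,t')) : (u,v)\in A,\ t'\equiv t+\tau_{(u,v)} \pmod T\}$. Let $\mathcal{P}=P\times[T]$. The arc set is partitioned as $\mathcal{A}=\mathcal{A}^{\mathrm{con}}\uplus\mathcal{A}^{\mathrm{out}}$ (consolidated and outsourced arcs). **Travel-time graph** $\mathscr{D}=(\mathscr{V},\mathscr{A})$: let $\mathcal{T}=\max_{o\in O}\tau_o$.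 The nodes are $(v,t)$ with $v\in S\cup P$ and $t\in\{0,\dots,\mathcal{T}\}$, and $(u,\mathcal{T})$ with $u\in U$; index $t$ means that $\mathcal{T}-t$ time steps remain until delivery. The arcs are all $((u,t),(v,t+\tau_{(u,v)}))$ with $(u,v)\in A$ and both endpoints in $\mathscr{V}$, together with the shortcut arcs $((s,t),(s,t+1))$, $s\in S$, $0\le t<\mathcal{T}$ (delaying dispatch by one step). **Projection.** For an order $o$ and a non-shortcut arc $\alpha=((u,t),(v,t'))\in\mathscr{A}$, $\pi_{\mathcal{D}}(\alpha,o)=((u,d_o-(\mathcal{T}-t)),(v,d_o-(\mathcal{T}-t')))\in\mathcal{A}$, times modulo $T$. For shortcut arcs, $\pi_{\mathcal{D}}(\alpha,o)=\emptyset$. $\delta^+(\cdot)$ and $\delta^-(\cdot)$ denote the sets of outgoing and incoming arcs in the relevant graph. **Variables.** $x_\alpha^b\in\{0,1\}$ ($b\in B,\alpha\in\mathscr{A}$); $f_a^m\in\mathbb{N}$ ($a\in\mathcal{A},m\in M$); $\tau_a^k\in\{0,1\}$ and $y_{ak}^m\in\mathbb{N}$ ($a\in\mathcal{A}^{\mathrm{con}}$, $k\in[K_a]$, $m\in M$); $z_p^t\ge0$ ($p\in P,t\in[T]$) and $z_p^{[T]}\ge0$ ($p\in P$), with $z_p^{\mathrm{total}}=\sum_{t\in[T]}z_p^t+z_p^{[T]}$. (The variables $\tau_a^k$ are bin-usage indicators, not travel times.) **Data.** $L_a>0$ is the bin capacity on $a\in\mathcal{A}$. $K_a\in\mathbb{N}$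 is the number of bins available on $a\in\mathcal{A}^{\mathrm{con}}$, assumed large enough that all $q_m$ units of all commodities $m\in M$ can be packed in $K_a$ bins of capacity $L_a$. $u_p^t\ge 0$ and $u_p^{[T]}\ge 0$ are platform capacities. All cost coefficients are nonnegative: the per-bin cost $c_a^{\mathrm{con}}$ (set to $0$ for $a\in\mathcal{A}^{\mathrm{out}}$), $c_a^{\mathrm{CO2}}$, $c_a^{\mathrm{out}}$, $c_v^{\mathrm{plat}}$, $c_p^{\mathrm{over}}$, and the capital cost $c_{am}^{\mathrm{cap}}$. For $a=(u,v)\in\mathcal{A}$, the composite cost is $$c_{am}^{\mathrm{com}}=\tfrac{\ell_m}{L_a}c_a^{\mathrm{CO2}}+c_{am}^{\mathrm{cap}}+\mathbb{I}(v\in\mathcal{P})\tfrac{\ell_m}{L_a}c_v^{\mathrm{plat}}+\mathbb{I}(a\notin\mathcal{A}^{\mathrm{con}})\tfrac{\ell_m}{L_a}c_a^{\mathrm{out}}.$$ **Constraints.** - (F1) $\sum_{\alpha\in\delta^+(\nu)}x_\alpha^b-\sum_{\alpha\in\delta^-(\nu)}x_\alpha^b=e_\nu^b$ for all $b\in B,\nu\in\mathscr{V}$, where $e_\nu^b=1$ if $\nu=(s_b,\mathcal{T}-\tau_b)$, $-1$ if $\nu=(u_b,\mathcal{T})$, and $0$ otherwise. - (F2) $\sum_{t}\sum_{\alpha\in\delta^-((p,t))}x_\alpha^b\le1$ for all $b\in B,p\in P$, where $t$ ranges over the time indices of $\mathscr{D}$. - (F3) $f^m_{\pi_{\mathcal{D}}(\alpha,o)}=q_m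 x_\alpha^b$ for all $b\in B$, $o\in b$, $m\in o$ and $\alpha\in\mathscr{A}$ with $\pi_{\mathcal{D}}(\alpha,o)\ne\emptyset$. - (P1) $f_a^m=\sum_{k\in[K_a]}y_{ak}^m$ for all $m\in M$, $a\in\mathcal{A}^{\mathrm{con}}$. - (P2) $\sum_{m\in M}y_{ak}^m\ell_m\le L_a\tau_a^k$ for all $a\in\mathcal{A}^{\mathrm{con}}$, $k\in[K_a]$. - (O1) $\sum_{a\in\delta^-((p,t))}\sum_{m\in M}f_a^m\ell_m\le u_p^t+z_p^t$ for all $(p,t)\in\mathcal{P}$. - (O2) $\sum_{t\in[T]}\sum_{a\in\delta^-((p,t))}\sum_{m\in M}f_a^m\ell_m\le u_p^{[T]}+z_p^{[T]}$ for all $p\in P$. **STPP** is the mixed-integer program $$\min\ \sum_{a\in\mathcal{A}^{\mathrm{con}}}\sum_{k\in[K_a]}c_a^{\mathrm{con}}\tau_a^k+\sum_{a\in\mathcal{A}}\sum_{m\in M}c_{am}^{\mathrm{com}}f_a^m+\sum_{p\in P}c_p^{\mathrm{over}}z_p^{\mathrm{total}}$$ subject to (F1), (F2), (F3), (P1), (P2), (O1), (O2) and the variable domains above. *)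

(* Defs.v *)
From HB Require Import structures.
From mathcomp Require Import all_boot all_order all_algebra.
From mathcomp Require Import boolp classical_sets reals constructive_ereal ereal.
Set Implicit Arguments.
Unset Strict Implicit.
Unset Printing Implicit Defensive.
Import Order.TTheory GRing.Theory Num.Theory.
Local Open Scope ring_scope.

(* V = S + P + U, with suppliers on the left, platforms in the middle and
   units on the right; the disjointness of the union is built in. *)
Definition vertex_of (S P U : finType) : finType := (S + P + U)%type.

Definition admissible_arc (S P U : finType) (v w : vertex_of S P U) : bool :=
  match v, w with
  | inl (inl _), inl (inr _) => true
  | inl (inr p), inl (inr p') => p != p'
  | inl (inr _), inr _ => true
  | inl (inl _), inr _ => true
  | _, _ => false
  end.

(* The horizon is T = horizon_pred.+1, hence T >= 1.  Time indices modulo T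
   live in 'I_T with its canonical Z/T group structure; the index T of
   [T] = {1, ..., T} is represented by the residue 0. *)
Record network := Network {
  supplier : finType;
  platform : finType;
  prod_unit : finType;
  horizon_pred : nat;
  arcs : {set vertex_of supplier platform prod_unit
              * vertex_of supplier platform prod_unit};
  travel_time : vertex_of supplier platform prod_unit
                -> vertex_of supplier platform prod_unit -> nat;
  arcs_admissible : forall v w, (v, w) \in arcs -> admissible_arc v w
}.

Definition vertex (N : network) : finType :=
  vertex_of (supplier N) (platform N) (prod_unit N).
Definition vsup (N : network) (s : supplier N) : vertex N := inl (inl s).
Definition vplat (N : network) (p : platform N) : vertex N := inl (inr p).
Definition vunit (N : network) (u : prod_unit N) : vertex N := inr u.

Definition is_supplier (N : network) (v : vertex N) : bool :=
  if v is inl (inl _) then true else false.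
Definition is_platform (N : network) (v : vertex N) : bool :=
  if v is inl (inr _) then true else false.
Definition is_unit (N : network) (v : vertex N) : bool :=
  if v is inr _ then true else false.

Definition time (N : network) : finType := 'I_(horizon_pred N).+1.

Definition ts_node (N : network) : finType := (vertex N * time N)%type.
Definition ts_arc (N : network) : finType := (ts_node N * ts_node N)%type.

Definition ts_arcs (N : network) : {set ts_arc N} :=
  [set a : ts_arc N | ((a.1.1, a.2.1) \in arcs N)
     && ((a.2.2 : 'I_(horizon_pred N).+1)
         == (a.1.2 : 'I_(horizon_pred N).+1)
            + inZp (travel_time a.1.1 a.2.1))].

(* Only the values of the arc-indexed data on ts_arcs (on arcs_con for
   num_bins) matter. *)
Record instance (R : realType) := Instance {
  net : network;

  commodity : finType;
  com_sup : commodity -> supplier net;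
  com_unit : commodity -> prod_unit net;
  com_date : commodity -> time net;
  volume : commodity -> R;
  mult : commodity -> nat;
  volume_gt0 : forall m, 0 < volume m;
  mult_gt0 : forall m, (0 < mult m)%N;

  orders : {set {set commodity}};
  ordersE : orders =
    preim_partition (fun m => (com_sup m, com_unit m, com_date m))
                    [set: commodity];
  ord_sup : {o | o \in orders} -> supplier net;
  ord_unit : {o | o \in orders} -> prod_unit net;
  ord_date : {o | o \in orders} -> time net;
  ord_time : {o | o \in orders} -> nat;
  ord_supE : forall (o : {o | o \in orders}) m,
    m \in val o -> com_sup m = ord_sup o;
  ord_unitE : forall (o : {o | o \in orders}) m,
    m \in val o -> com_unit m = ord_unit o;
  ord_dateE : forall (o : {o | o \in orders}) m,
    m \in val o -> com_date m = ord_date o;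

  bundles : {set {set {o | o \in orders}}};
  bundlesE : bundles =
    preim_partition (fun o => (ord_sup o, ord_unit o))
                    [set: {o | o \in orders}];
  bun_sup : {b | b \in bundles} -> supplier net;
  bun_unit : {b | b \in bundles} -> prod_unit net;
  bun_time : {b | b \in bundles} -> nat;
  bun_supE : forall (b : {b | b \in bundles}) o,
    o \in val b -> ord_sup o = bun_sup b;
  bun_unitE : forall (b : {b | b \in bundles}) o,
    o \in val b -> ord_unit o = bun_unit b;
  bun_timeE : forall (b : {b | b \in bundles}) o,
    o \in val b -> ord_time o = bun_time b;

  arcs_con : {set ts_arc net};
  arcs_con_sub : arcs_con \subset ts_arcs net;

  capacity : ts_arc net -> R;
  capacity_gt0 : forall a, a \in ts_arcs net -> 0 < capacity a;

  num_bins : ts_arc net -> nat;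
  (* All units of all commodities fit in the bins of each consolidated arc:
     n k m is the number of units of m put in bin k. *)
  num_bins_large : forall a, a \in arcs_con ->
    exists n : nat -> commodity -> nat,
      (forall m, (\sum_(k < num_bins a) n k m)%N = mult m)
      /\ (forall k, (k < num_bins a)%N ->
            \sum_(m : commodity) (n k m)%:R * volume m <= capacity a);

  plat_cap : platform net -> time net -> R;
  plat_cap_total : platform net -> R;
  plat_cap_ge0 : forall p t, 0 <= plat_cap p t;
  plat_cap_total_ge0 : forall p, 0 <= plat_cap_total p;

  cost_con : ts_arc net -> R;
  cost_co2 : ts_arc net -> R;
  cost_out : ts_arc net -> R;
  cost_plat : ts_node net -> R;
  cost_over : platform net -> R;
  cost_cap : ts_arc net -> commodity -> R;
  cost_con_ge0 : forall a, a \in ts_arcs net -> 0 <= cost_con a;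
  cost_con_out : forall a, a \in ts_arcs net :\: arcs_con -> cost_con a = 0;
  cost_co2_ge0 : forall a, a \in ts_arcs net -> 0 <= cost_co2 a;
  cost_out_ge0 : forall a, a \in ts_arcs net -> 0 <= cost_out a;
  cost_plat_ge0 : forall v, is_platform v.1 -> 0 <= cost_plat v;
  cost_over_ge0 : forall p, 0 <= cost_over p;
  cost_cap_ge0 : forall a m, a \in ts_arcs net -> 0 <= cost_cap a m
}.

Definition com_order (R : realType) (I : instance R) : finType :=
  {o : {set commodity I} | o \in orders I}.
Definition com_bundle (R : realType) (I : instance R) : finType :=
  {b : {set {o : {set commodity I} | o \in orders I}} | b \in bundles I}.

Definition cost_com (R : realType) (I : instance R)
    (a : ts_arc (net I)) (m : commodity I) : R :=
  volume m / capacity a * cost_co2 a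
  + cost_cap a m
  + (is_platform a.2.1)%:R * (volume m / capacity a * cost_plat a.2)
  + (a \notin arcs_con I)%:R * (volume m / capacity a * cost_out a).

Definition cost_lin (R : realType) (I : instance R)
    (a : ts_arc (net I)) (m : commodity I) : R :=
  cost_com a m + volume m / capacity a * cost_con a.

Definition max_time (R : realType) (I : instance R) : nat :=
  \max_(o : com_order I) ord_time o.

Definition tt_node (R : realType) (I : instance R) : finType :=
  (vertex (net I) * 'I_(max_time I).+1)%type.
Definition tt_arc (R : realType) (I : instance R) : finType :=
  (tt_node I * tt_node I)%type.

Definition tt_nodes (R : realType) (I : instance R) : {set tt_node I} :=
  [set v : tt_node I | is_unit v.1 ==> (v.2 == max_time I :> nat)].

Definition tt_shortcuts (R : realType) (I : instance R) : {set tt_arc I} :=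
  [set al : tt_arc I | [&& is_supplier al.1.1, al.2.1 == al.1.1
                         & al.2.2 == al.1.2.+1 :> nat]].

Definition tt_arcs (R : realType) (I : instance R) : {set tt_arc I} :=
  [set al : tt_arc I |
     [&& al.1 \in tt_nodes I, al.2 \in tt_nodes I,
         (al.1.1, al.2.1) \in arcs (net I)
       & al.2.2 == (al.1.2 + travel_time al.1.1 al.2.1)%N :> nat]]
  :|: tt_shortcuts I.

(* d_o - (max_time - t) modulo T. *)
Definition proj_time (R : realType) (I : instance R) (o : com_order I)
    (t : 'I_(max_time I).+1) : time (net I) :=
  (ord_date o : 'I_(horizon_pred (net I)).+1) - inZp (max_time I - t).

(* None encodes the empty projection of shortcut arcs. *)
Definition proj (R : realType) (I : instance R) (al : tt_arc I) (o : com_order I) :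
    option (ts_arc (net I)) :=
  if al \in tt_shortcuts I then None
  else Some ((al.1.1, proj_time o al.1.2), (al.2.1, proj_time o al.2.2)).

(* Bins are numbered from 0 to num_bins a - 1. *)
Record variables (R : realType) (I : instance R) := Variables {
  var_x : com_bundle I -> tt_arc I -> R;
  var_f : ts_arc (net I) -> commodity I -> R;
  var_bin : ts_arc (net I) -> nat -> R;
  var_y : ts_arc (net I) -> nat -> commodity I -> R;
  var_z : platform (net I) -> time (net I) -> R;
  var_ztot : platform (net I) -> R
}.

Definition z_total (R : realType) (I : instance R)
    (z : platform (net I) -> time (net I) -> R) (zT : platform (net I) -> R)
    (p : platform (net I)) : R :=
  \sum_(t : time (net I)) z p t + zT p.

Definition path_rhs (R : realType) (I : instance R) (b : com_bundle I)
    (v : tt_node I) : R :=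
  if (v.1 == vsup (bun_sup b)) && (v.2 == (max_time I - bun_time b)%N :> nat)
  then 1
  else if (v.1 == vunit (bun_unit b)) && (v.2 == max_time I :> nat) then -1
  else 0.

Definition path_constr (R : realType) (I : instance R) (b : com_bundle I)
    (xb : tt_arc I -> R) : Prop :=
  forall v : tt_node I, v \in tt_nodes I ->
    \sum_(al in tt_arcs I | al.1 == v) xb al
    - \sum_(al in tt_arcs I | al.2 == v) xb al = path_rhs b v.

Definition elem_constr (R : realType) (I : instance R)
    (xb : tt_arc I -> R) : Prop :=
  forall p : platform (net I),
    \sum_(t : 'I_(max_time I).+1)
      \sum_(al in tt_arcs I | al.2 == (vplat p, t)) xb al <= 1.

Definition proj_constr (R : realType) (I : instance R) (b : com_bundle I)
    (xb : tt_arc I -> R) (f : ts_arc (net I) -> commodity I -> R) : Prop :=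
  forall (o : com_order I) (m : commodity I) (al : tt_arc I) (a : ts_arc (net I)),
    o \in val b -> m \in val o -> al \in tt_arcs I -> proj al o = Some a ->
    f a m = (mult m)%:R * xb al.

Definition packing_constr (R : realType) (I : instance R)
    (f : ts_arc (net I) -> commodity I -> R)
    (bin : ts_arc (net I) -> nat -> R)
    (y : ts_arc (net I) -> nat -> commodity I -> R) : Prop :=
  (forall m a, a \in arcs_con I -> f a m = \sum_(k < num_bins a) y a k m)
  /\ (forall a k, a \in arcs_con I -> (k < num_bins a)%N ->
        \sum_(m : commodity I) y a k m * volume m <= capacity a * bin a k).

Definition overload_constr (R : realType) (I : instance R)
    (f : ts_arc (net I) -> commodity I -> R)
    (z : platform (net I) -> time (net I) -> R)
    (zT : platform (net I) -> R) : Prop :=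
  (forall p t,
     \sum_(a in ts_arcs (net I) | a.2 == (vplat p, t))
       \sum_(m : commodity I) f a m * volume m <= plat_cap p t + z p t)
  /\ (forall p,
     \sum_(t : time (net I))
       \sum_(a in ts_arcs (net I) | a.2 == (vplat p, t))
         \sum_(m : commodity I) f a m * volume m <= plat_cap_total p + zT p).

Definition binary (R : realType) : set R := [set r | r = 0 \/ r = 1]%classic.
Definition natural (R : realType) : set R :=
  [set r | exists n : nat, r = n%:R]%classic.
Definition unit_interval (R : realType) : set R := [set r | 0 <= r <= 1]%classic.
Definition nonneg (R : realType) : set R := [set r | 0 <= r]%classic.

(* The domains of x, bin (dom01) and of f, y (domN) are parameters:
   (binary, natural) gives STPP, (unit_interval, nonneg) its linear
   relaxation. *)
Definition stpp_core_feasible (R : realType) (I : instance R)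
    (dom01 domN : set R) (w : variables I) : Prop :=
  [/\ [/\ forall b al, al \in tt_arcs I ->
            dom01 (var_x w b al),
          forall a m, a \in ts_arcs (net I) -> domN (var_f w a m),
          forall a k, a \in arcs_con I -> (k < num_bins a)%N ->
            dom01 (var_bin w a k)
        & forall a k m, a \in arcs_con I -> (k < num_bins a)%N ->
            domN (var_y w a k m)],
      forall b : com_bundle I, path_constr b (var_x w b),
      forall b : com_bundle I, elem_constr (var_x w b),
      forall b : com_bundle I, proj_constr b (var_x w b) (var_f w)
    & packing_constr (var_f w) (var_bin w) (var_y w)].

Definition z_feasible (R : realType) (I : instance R)
    (f : ts_arc (net I) -> commodity I -> R)
    (z : platform (net I) -> time (net I) -> R)
    (zT : platform (net I) -> R) : Prop :=
  [/\ forall p t, 0 <= z p t, forall p, 0 <= zT p & overload_constr f z zT].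

Definition stpp_core_obj (R : realType) (I : instance R) (w : variables I) : R :=
  \sum_(a in arcs_con I) \sum_(k < num_bins a) cost_con a * var_bin w a k
  + \sum_(a in ts_arcs (net I)) \sum_(m : commodity I)
      cost_com a m * var_f w a m.

Definition over_obj (R : realType) (I : instance R)
    (z : platform (net I) -> time (net I) -> R)
    (zT : platform (net I) -> R) : R :=
  \sum_(p : platform (net I)) cost_over p * z_total z zT p.

(* Optimal values are infima in the extended reals, with value +oo when there
   is no feasible point. *)
Definition opt_value (R : realType) (X : Type) (feasible : X -> Prop)
    (obj : X -> R) : \bar R :=
  ereal_inf [set (obj w)%:E | w in [set w | feasible w]]%classic.

Definition stpp_opt (R : realType) (I : instance R) (dom01 domN : set R) :
    \bar R :=
  opt_value
    (fun w : variables I => stpp_core_feasible dom01 domN w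
                            /\ z_feasible (var_f w) (var_z w) (var_ztot w))
    (fun w => stpp_core_obj w + over_obj (var_z w) (var_ztot w)).

Definition stpp_no_overload_opt (R : realType) (I : instance R)
    (dom01 domN : set R) : \bar R :=
  opt_value (fun w : variables I => stpp_core_feasible dom01 domN w)
            (fun w => stpp_core_obj w).

Definition STPP_value (R : realType) (I : instance R) : \bar R :=
  stpp_opt I (@binary R) (@natural R).
Definition STPP_relax_value (R : realType) (I : instance R) : \bar R :=
  stpp_opt I (@unit_interval R) (@nonneg R).

Definition STPP_no_overload_value (R : realType) (I : instance R) : \bar R :=
  stpp_no_overload_opt I (@binary R) (@natural R).
Definition STPP_no_overload_relax_value (R : realType) (I : instance R) :
    \bar R :=
  stpp_no_overload_opt I (@unit_interval R) (@nonneg R).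

Record lp_variables (R : realType) (I : instance R) := LPVariables {
  lp_x : com_bundle I -> tt_arc I -> R;
  lp_f : ts_arc (net I) -> commodity I -> R;
  lp_z : platform (net I) -> time (net I) -> R;
  lp_ztot : platform (net I) -> R
}.

Definition lp_feasible (R : realType) (I : instance R) (w : lp_variables I) :
    Prop :=
  [/\ (forall b al, al \in tt_arcs I ->
         0 <= lp_x w b al <= 1)
      /\ (forall a m, a \in ts_arcs (net I) -> 0 <= lp_f w a m),
      forall b : com_bundle I, path_constr b (lp_x w b),
      forall b : com_bundle I, elem_constr (lp_x w b),
      forall b : com_bundle I, proj_constr b (lp_x w b) (lp_f w)
    & z_feasible (lp_f w) (lp_z w) (lp_ztot w)].

Definition lp_obj (R : realType) (I : instance R) (w : lp_variables I) : R :=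
  \sum_(a in ts_arcs (net I)) \sum_(m : commodity I) cost_lin a m * lp_f w a m
  + over_obj (lp_z w) (lp_ztot w).

Definition LP_value (R : realType) (I : instance R) : \bar R :=
  opt_value (@lp_feasible R I) (@lp_obj R I).

(* The linear program of a single bundle b; only the entries of f at the
   commodities m \in o \in b are constrained or priced. *)
Definition bundle_feasible (R : realType) (I : instance R) (b : com_bundle I)
    (w : (tt_arc I -> R) * (ts_arc (net I) -> commodity I -> R)) : Prop :=
  [/\ (forall al, al \in tt_arcs I -> 0 <= w.1 al <= 1)
      /\ (forall a (o : com_order I) m, a \in ts_arcs (net I) ->
            o \in val b -> m \in val o -> 0 <= w.2 a m),
      path_constr b w.1,
      elem_constr w.1
    & proj_constr b w.1 w.2].

Definition bundle_obj (R : realType) (I : instance R) (b : com_bundle I)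
    (w : (tt_arc I -> R) * (ts_arc (net I) -> commodity I -> R)) : R :=
  \sum_(a in ts_arcs (net I)) \sum_(o : com_order I | o \in val b)
    \sum_(m : commodity I | m \in val o) cost_lin a m * w.2 a m.

Definition bundle_value (R : realType) (I : instance R) (b : com_bundle I) :
    \bar R :=
  opt_value (@bundle_feasible R I b) (@bundle_obj R I b).

(* Main.v *)
Require Import Defs.
From mathcomp Require Import boolp classical_sets ereal.
From mathcomp Require Import all_boot all_order all_algebra.
From mathcomp Require Import reals constructive_ereal.
Set Implicit Arguments.
Unset Strict Implicit.
Unset Printing Implicit Defensive.
Import Order.TTheory GRing.Theory Num.Theory.
Local Open Scope ring_scope.

(** In the linear relaxation the bins can be filled fractionally, so the bin
    variables disappear: the capacity constraint forces the total use of the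
    bins of an arc to be at least the volume it carries divided by the bin
    capacity ([flow_cost_le_core_obj]), and this bound is attained.  Charging
    bins is thus the same as adding volume / capacity * cost_con to the unit
    cost of each flow, which is what [cost_lin] does.

    The point that needs care in attaining the bound is that the bin variables
    are at most 1, whereas the flow variables of the linear program are not
    bounded on time-space arcs that are the projection of no travel-time arc.
    Truncating every flow f a m at mult m settles this: costs and volumes are
    nonnegative, so neither the objective nor the platform loads increase, and
    a projected flow, of the form mult m * x with x <= 1, is not changed
    ([truncate_feasible]).  Once f a m <= mult m, the packing of all units in
    the bins of the arc, which the instance guarantees, is scaled by
    f a m / mult m commodity by commodity; no bin then receives more than its
    capacity ([fractional_packing]).  This gives the first equality, and
    without overload it reduces the relaxation to a linear program in x and f.

    That last program is separable: every commodity lies in exactly one bundle,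
    and no constraint or cost term involves two bundles.  All costs are
    nonnegative, so the infimum of a sum of independent costs is the sum of the
    infima, including when some bundle is infeasible ([opt_value_separable]).
 *)

(** * Index functions of partitions *)

Lemma partition_index (T : finType) (P : {set {set T}}) :
  partition P [set: T] ->
  {h : T -> {B | B \in P} | forall x (B : {B | B \in P}), (x \in val B) = (h x == B)}.
Proof.
move=> /and3P[/eqP cov tri _].
have xP x : pblock P x \in P by rewrite pblock_mem // cov inE.
exists (fun x => exist _ (pblock P x) (xP x)) => x [B BP].
rewrite -val_eqE /=; apply/idP/eqP => [xB | <-]; first exact: def_pblock.
by rewrite mem_pblock cov inE.
Qed.

(** * Infima of optimization problems *)

Lemma opt_value_le (R : realType) (X Y : Type) (fX : X -> Prop) (fY : Y -> Prop)
    (oX : X -> R) (oY : Y -> R) :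
  (forall y, fY y -> exists2 x, fX x & oX x <= oY y) ->
  (opt_value fX oX <= opt_value fY oY)%E.
Proof.
move=> XY; apply: le_ereal_inf_tmp => _ [y /= fy <-].
have [x fx xy] := XY y fy.
apply: (@le_trans _ _ (oX x)%:E); last by rewrite lee_fin.
by apply: ereal_inf_lbound; exists x.
Qed.

Lemma opt_value_ge0 (R : realType) (X : Type) (fX : X -> Prop) (oX : X -> R) :
  (forall x, fX x -> 0 <= oX x) -> (0 <= opt_value fX oX)%E.
Proof.
by move=> o0; apply: le_ereal_inf_tmp => _ [x /= fx <-]; rewrite lee_fin o0.
Qed.

(** Nonnegativity of the costs keeps the sum of the infima away from -oo + +oo,
    so that a single infeasible component makes both sides infinite; otherwise
    near-optimal solutions of the components are glued together. *)
Lemma opt_value_separable (R : realType) (B : finType) (X : B -> Type)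
    (Y : Type) (fX : forall b, X b -> Prop) (oX : forall b, X b -> R)
    (fY : Y -> Prop) (oY : Y -> R) :
  (forall b x, fX b x -> 0 <= oX b x) ->
  (forall y, fY y -> exists2 x : forall b, X b,
     forall b, fX b (x b) & oY y = \sum_b oX b (x b)) ->
  (forall x : forall b, X b, (forall b, fX b (x b)) ->
     exists2 y, fY y & oY y = \sum_b oX b (x b)) ->
  opt_value fY oY = (\sum_b opt_value (fX b) (oX b))%E.
Proof.
move=> o0 split glue; apply/eqP; rewrite eq_le; apply/andP; split; last first.
  apply: le_ereal_inf_tmp => _ [y /= fy <-]; have [x fx ->] := split y fy.
  rewrite -sumEFin; apply: lee_sum => b _.
  by apply: ereal_inf_lbound; exists (x b).
have v0 b : (0 <= opt_value (fX b) (oX b))%E by exact: opt_value_ge0 (o0 b).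
have [/forallP fin|] := boolP [forall b, opt_value (fX b) (oX b) != +oo%E]; last first.
  move=> /forallPn[b /negPn/eqP vb].
  rewrite (bigD1 b) //= vb addye ?leey // gt_eqF //.
  by rewrite (lt_le_trans ltNy0) // sume_ge0.
have vfin b : opt_value (fX b) (oX b) \is a fin_num.
  by rewrite ge0_fin_numE // ltey.
apply/lee_addgt0Pr => e e0.
(* The tolerance e is shared among the components; the successor in the
   denominator covers an empty index type. *)
pose d := e / #|B|.+1%:R.
have d0 : 0 < d by rewrite divr_gt0.
have near b : {x | fX b x /\ ((oX b x)%:E <= opt_value (fX b) (oX b) + d%:E)%E}.
  apply: cid; have [_ [x fx <-] xd] := lb_ereal_inf_adherent d0 (vfin b).
  by exists x; split=> //; exact: ltW.
have [y fy oy] := glue (fun b => sval (near b)) (fun b => (svalP (near b)).1).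
apply: (@le_trans _ _ (oY y)%:E); first by apply: ereal_inf_lbound; exists y.
rewrite oy -sumEFin.
apply: (@le_trans _ _ (\sum_b (opt_value (fX b) (oX b) + d%:E))%E).
  by apply: lee_sum => b _; exact: (svalP (near b)).2.
rewrite big_split /= leeD2l // sumEFin lee_fin sumr_const -mulr_natr -mulrA.
rewrite ler_piMr ?(ltW e0) // mulrC ler_pdivrMr // mul1r ler_nat.
exact: leqnSn.
Qed.

(** * Bins and linearized costs *)

Section Instance.
Variables (R : realType) (I : instance R).
Implicit Types (a : ts_arc (net I)) (m : commodity I) (b : com_bundle I).
Implicit Types (x : com_bundle I -> tt_arc I -> R).
Implicit Types (f : ts_arc (net I) -> commodity I -> R).

Definition flow_feasible x f : Prop :=
  [/\ (forall b al, al \in tt_arcs I -> 0 <= x b al <= 1)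
      /\ (forall a m, a \in ts_arcs (net I) -> 0 <= f a m),
      forall b, path_constr b (x b),
      forall b, elem_constr (x b)
    & forall b, proj_constr b (x b) f].

Definition flow_cost f : R :=
  \sum_(a in ts_arcs (net I)) \sum_(m : commodity I) cost_lin a m * f a m.

Lemma cost_lin_ge0 a m : a \in ts_arcs (net I) -> 0 <= cost_lin a m.
Proof.
move=> aA; have r0 : 0 <= volume m / capacity a.
  by rewrite divr_ge0 ?ltW ?volume_gt0 ?capacity_gt0.
rewrite /cost_lin /cost_com !addr_ge0 //.
- by rewrite mulr_ge0 ?cost_co2_ge0.
- exact: cost_cap_ge0.
- case: (boolP (is_platform a.2.1)) => [pl|_]; last by rewrite mul0r.
  by rewrite mul1r mulr_ge0 ?cost_plat_ge0.
- by rewrite mulr_ge0 // mulr_ge0 ?cost_out_ge0.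
- by rewrite mulr_ge0 ?cost_con_ge0.
Qed.

(** The linearized cost charges each arc for the fractional number of full bins
    that its load would occupy; arcs without consolidation have no bin cost. *)
Lemma flow_costE f :
  flow_cost f =
    \sum_(a in arcs_con I)
      cost_con a * ((\sum_(m : commodity I) f a m * volume m) / capacity a)
    + \sum_(a in ts_arcs (net I)) \sum_(m : commodity I) cost_com a m * f a m.
Proof.
rewrite [X in X + _](_ : _ = \sum_(a in ts_arcs (net I))
   cost_con a * ((\sum_(m : commodity I) f a m * volume m) / capacity a)).
  rewrite -big_split; apply: eq_bigr => a _ /=.
  rewrite big_distrl /= big_distrr /= -big_split; apply: eq_bigr => m _ /=.
  rewrite /cost_lin mulrDl addrC; congr (_ + _).
  by rewrite -!mulrA [RHS]mulrC -!mulrA mulrC -!mulrA.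
rewrite [RHS](big_setID (arcs_con I)) /= (setIidPr (arcs_con_sub I)).
rewrite [X in _ + X]big1 ?addr0 // => a aD.
by rewrite cost_con_out // mul0r.
Qed.

(** Summing the capacity constraint over the bins of an arc bounds its load by
    its capacity times its total bin usage. *)
Lemma flow_cost_le_core_obj (w : variables I) :
  packing_constr (var_f w) (var_bin w) (var_y w) ->
  flow_cost (var_f w) <= stpp_core_obj w.
Proof.
move=> [fE cap]; rewrite flow_costE lerD2r; apply: ler_sum => a ac.
have aA := subsetP (arcs_con_sub I) _ ac.
rewrite -big_distrr /= ler_wpM2l ?cost_con_ge0 // ler_pdivrMr ?capacity_gt0 //.
rewrite (eq_bigr (fun m => \sum_(k < num_bins a) var_y w a k m * volume m)).
  rewrite exchange_big /= mulrC big_distrr /=; apply: ler_sum => k _.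
  exact: cap.
by move=> m _; rewrite fE // big_distrl.
Qed.

(** The bounds by [mult] are what makes the bin usages at most 1: each bin
    receives the fraction f a m / mult m of its share of m in a packing of all
    units, hence at most the load of that packing.  Each bin is charged exactly
    for its load, so no cost is lost. *)
Lemma fractional_packing f :
  (forall a m, a \in ts_arcs (net I) -> 0 <= f a m <= (mult m)%:R) ->
  exists bin y, [/\
    packing_constr f bin y,
    forall a k, a \in arcs_con I -> (k < num_bins a)%N -> 0 <= bin a k <= 1,
    forall a k m, a \in arcs_con I -> (k < num_bins a)%N -> 0 <= y a k m
  & forall x z zT,
      stpp_core_obj (Variables x f bin y z zT) = flow_cost f].
Proof.
move=> f01.
have /choice[n nP] a : exists n : nat -> commodity I -> nat,
    a \in arcs_con I ->
    (forall m, (\sum_(k < num_bins a) n k m)%N = mult m)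
    /\ (forall k, (k < num_bins a)%N ->
          \sum_(m : commodity I) (n k m)%:R * volume m <= capacity a).
  have [ac|_] := boolP (a \in arcs_con I); last by exists (fun _ _ => 0%N).
  by have [n nP] := num_bins_large ac; exists n.
pose y a k m : R := f a m * ((n a k m)%:R / (mult m)%:R).
pose bin a k : R := (\sum_(m : commodity I) y a k m * volume m) / capacity a.
have q0 m : 0 < (mult m)%:R :> R by rewrite ltr0n mult_gt0.
have y0 a k m : a \in arcs_con I -> 0 <= y a k m.
  move=> ac; have /andP[f0 _] := f01 a m (subsetP (arcs_con_sub I) _ ac).
  by rewrite mulr_ge0 // divr_ge0.
have yE m a : a \in arcs_con I -> f a m = \sum_(k < num_bins a) y a k m.
  move=> ac; rewrite -big_distrr -big_distrl /= -natr_sum (nP a ac).1.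
  by rewrite divff ?mulr1 // gt_eqF.
exists bin, y; split.
- split=> // a k ac _.
  by rewrite /bin mulrC divfK // gt_eqF // capacity_gt0 // (subsetP (arcs_con_sub I)).
- move=> a k ac kK; have aA := subsetP (arcs_con_sub I) _ ac.
  have c0 : 0 < capacity a by exact: capacity_gt0.
  rewrite divr_ge0 ?(ltW c0) //=; last first.
    by apply: sumr_ge0 => m _; rewrite mulr_ge0 ?y0 // ltW // volume_gt0.
  rewrite ler_pdivrMr // mul1r.
  apply: le_trans ((nP a ac).2 k kK); apply: ler_sum => m _.
  rewrite ler_wpM2r ?(ltW (volume_gt0 m)) // /y mulrCA.
  have /andP[_ fq] := f01 a m aA.
  by rewrite ler_piMr // ler_pdivrMr // mul1r.
- by move=> a k m ac _; exact: y0.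
- move=> x z zT; rewrite flow_costE /stpp_core_obj /=; congr (_ + _).
  apply: eq_bigr => a ac; rewrite -big_distrr -big_distrl /=.
  rewrite exchange_big /=; congr (_ * (_ / _)); apply: eq_bigr => m _.
  by rewrite yE // big_distrl.
Qed.

(** * Truncation of the flows *)

Definition truncate f a m : R := Num.min (f a m) (mult m)%:R.

Lemma truncate_le f a m : truncate f a m <= f a m.
Proof. by rewrite ge_min lexx. Qed.

Lemma truncate_bounds x f a m :
  flow_feasible x f -> a \in ts_arcs (net I) ->
  0 <= truncate f a m <= (mult m)%:R.
Proof.
by move=> [[_ f0] _ _ _] aA; rewrite le_min f0 // ler0n ge_min lexx orbT.
Qed.

(** Where the projection constraint applies, x <= 1 already bounds the flow by
    [mult], so truncation only acts on the flows left free by it. *)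
Lemma truncate_feasible x f :
  flow_feasible x f -> flow_feasible x (truncate f).
Proof.
move=> xf; have [[x01 f0] path elem prj] := xf; split=> //.
  by split=> // a m aA; have /andP[] := truncate_bounds m xf aA.
move=> b o m al a ob mo alA ala; rewrite /truncate (prj b o m al a) //.
have /andP[_ x1] := x01 b al alA.
by apply/min_idPl; rewrite ler_piMr.
Qed.

Lemma flow_cost_le f g :
  (forall a m, f a m <= g a m) -> flow_cost f <= flow_cost g.
Proof.
move=> fg; apply: ler_sum => a aA; apply: ler_sum => m _.
by rewrite ler_wpM2l ?cost_lin_ge0.
Qed.

Lemma z_feasible_le f g z zT :
  (forall a m, f a m <= g a m) -> z_feasible g z zT -> z_feasible f z zT.
Proof.
move=> fg [z0 zT0 [inst total]].
have load p t : \sum_(a in ts_arcs (net I) | a.2 == (vplat p, t))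
    \sum_(m : commodity I) f a m * volume m <=
  \sum_(a in ts_arcs (net I) | a.2 == (vplat p, t))
    \sum_(m : commodity I) g a m * volume m.
  apply: ler_sum => a _; apply: ler_sum => m _.
  by rewrite ler_wpM2r // ltW // volume_gt0.
split=> //; split=> [p t | p]; first exact: le_trans (inst p t).
by apply: le_trans (total p); apply: ler_sum => t _.
Qed.

(** * Elimination of the bin variables *)

Lemma relax_flow_feasible (w : variables I) :
  stpp_core_feasible (@unit_interval R) (@nonneg R) w ->
  flow_feasible (var_x w) (var_f w).
Proof. by move=> [[x01 f0 _ _] path elem prj _]; split. Qed.

Lemma flow_relax_feasible x f z zT :
  flow_feasible x f -> exists bin y,
    let w := Variables x (truncate f) bin y z zT in
    stpp_core_feasible (@unit_interval R) (@nonneg R) w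
    /\ stpp_core_obj w <= flow_cost f.
Proof.
move=> xf; have bnd a m := @truncate_bounds x f a m xf.
have [bin [y [pack bin01 y0 objE]]] := fractional_packing bnd.
exists bin, y; split; last by rewrite objE; apply: flow_cost_le (truncate_le f).
by have [[x01 f0] path elem prj] := truncate_feasible xf; split.
Qed.

Lemma overload_relax_value : STPP_relax_value I = LP_value I.
Proof.
apply: le_anti; apply/andP; split; apply: opt_value_le.
  move=> [x f z zT] [/= [x01 f0] path elem prj zf].
  have xf : flow_feasible x f by split.
  have [bin [y [feas obj]]] := flow_relax_feasible z zT xf.
  exists (Variables x (truncate f) bin y z zT); last by rewrite lerD2r.
  by split=> //; exact: z_feasible_le (truncate_le f) zf.
move=> w [core zf].
have [[x01 f0] path elem prj] := relax_flow_feasible core.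
exists (LPVariables (var_x w) (var_f w) (var_z w) (var_ztot w)); first by split.
by rewrite lerD2r; apply: flow_cost_le_core_obj; case: core.
Qed.

Lemma no_overload_relax_flow :
  STPP_no_overload_relax_value I =
  opt_value (fun w => flow_feasible w.1 w.2) (fun w => flow_cost w.2).
Proof.
apply: le_anti; apply/andP; split; apply: opt_value_le.
  move=> [x f] /= /(flow_relax_feasible (fun _ _ => 0) (fun _ => 0)).
  by move=> [bin [y [feas obj]]]; eexists; [exact: feas | exact: obj].
move=> w core; exists (var_x w, var_f w); first exact: relax_flow_feasible.
by apply: flow_cost_le_core_obj; case: core.
Qed.

(** * Decomposition by bundles *)

(** The orders partition the commodities and the bundles partition the orders,
    which gives each commodity an order and each order a bundle. *)
Lemma commodity_index :
  {h : (commodity I -> com_order I) * (com_order I -> com_bundle I) |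
    (forall m (o : com_order I), (m \in val o) = (h.1 m == o))
    /\ (forall o b, (o \in val b) = (h.2 o == b))}.
Proof.
have ordP : partition (orders I) [set: commodity I].
  by rewrite ordersE; exact: preim_partitionP.
have bunP : partition (bundles I) [set: com_order I].
  by rewrite bundlesE; exact: preim_partitionP.
have [ho hoE] := partition_index ordP.
have [hb hbE] := partition_index bunP.
by exists (ho, hb).
Qed.

Lemma sum_by_bundle (F : commodity I -> R) :
  \sum_(m : commodity I) F m =
  \sum_(b : com_bundle I) \sum_(o : com_order I | o \in val b)
    \sum_(m : commodity I | m \in val o) F m.
Proof.
have [[ho hb] [/= hoE hbE]] := commodity_index.
rewrite (partition_big ho predT) //= (partition_big hb predT) //=.
apply: eq_bigr => b _; apply: eq_big => [o|o _]; first by rewrite hbE.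
by apply: eq_bigl => m; rewrite hoE.
Qed.

Lemma flow_cost_bundles f x :
  flow_cost f = \sum_(b : com_bundle I) bundle_obj b (x b, f).
Proof.
rewrite exchange_big /=; apply: eq_bigr => a _; exact: sum_by_bundle.
Qed.

(** The flow of a commodity is read from the solution of its own bundle, the
    only one whose constraints and costs involve it. *)
Lemma flow_value_bundles :
  opt_value (fun w => flow_feasible w.1 w.2) (fun w => flow_cost w.2)
  = (\sum_(b : com_bundle I) bundle_value b)%E.
Proof.
have [[ho hb] [/= hoE hbE]] := commodity_index.
apply: opt_value_separable => [b w [[_ f0] _ _ _] | [x f] /= xf | w wP].
- apply: sumr_ge0 => a aA; apply: sumr_ge0 => o ob; apply: sumr_ge0 => m mo.
  by rewrite mulr_ge0 ?cost_lin_ge0 // (f0 a o m).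
- exists (fun b => (x b, f)); last exact: flow_cost_bundles.
  move=> b; have [[x01 f0] path elem prj] := xf.
  split; [split=> [al|a o m aA _ _] | exact: path | exact: elem | exact: prj].
    exact: x01.
  exact: f0.
pose x b := (w b).1; pose f a m := (w (hb (ho m))).2 a m.
have fE b (o : com_order I) m a : o \in val b -> m \in val o -> f a m = (w b).2 a m.
  by rewrite hoE hbE => /eqP <- /eqP <-.
exists (x, f) => /=.
  split.
  - split=> [b al alA | a m aA]; first by have [[x01 _] _ _ _] := wP b; exact: x01.
    have [[_ f0] _ _ _] := wP (hb (ho m)).
    by apply: (f0 a (ho m)); rewrite ?hbE ?hoE.
  - by move=> b; have [] := wP b.
  - by move=> b; have [] := wP b.
  - move=> b o m al a ob mo alA ala; have [_ _ _ prj] := wP b.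
    by rewrite (fE b o) //; exact: prj ala.
rewrite (flow_cost_bundles f x); apply: eq_bigr => b _.
apply: eq_bigr => a _; apply: eq_bigr => o ob; apply: eq_bigr => m mo /=.
by rewrite (fE b o).
Qed.

End Instance.

Theorem proposition2 (R : realType) (I : instance R) :
  STPP_relax_value I = LP_value I
  /\ STPP_no_overload_relax_value I
     = (\sum_(b : com_bundle I) bundle_value b)%E.
Proof.
split; first exact: overload_relax_value.
by rewrite no_overload_relax_flow flow_value_bundles.
Qed.
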